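(* Let $L\subseteq\mathbb{S}_n$ be a vector subspace and $c\in\mathbb{S}_n$. If $(K_n,L,c)$ is weakly infeasible, then there exist a vector subspace $L'\subseteq\mathbb{S}_n$ and $c'\in\mathbb{S}_n$ such that the affine space $L'+c'$ has dimension at most $n-1$, $L'+c'\subseteq L+c$, and $(K_n,L',c')$ is weakly infeasible.
   Context: $\mathbb{S}_n$ is the space of real symmetric $n\times n$ matrices and $K_n\subseteq\mathbb{S}_n$ is the cone of positive semidefinite matrices. For a vector subspace $L\subseteq\mathbb{S}_n$ and $c\in\mathbb{S}_n$, $(K_n,L,c)$ denotes the semidefinite feasibility problem of finding $x\in(L+c)\cap K_n$. It is called weakly infeasible if $(L+c)\cap K_n=\emptyset$ and $\mathrm{dist}(K_n,L+c)=0$, where $\mathrm{dist}(C,D)=\inf\{\|x-y\|: x\in C,\ y\in D\}$ with the Frobenius norm. *)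

(* Defs.v *)
From mathcomp Require Import all_boot all_order all_algebra.
From mathcomp Require Import all_classical all_reals ereal.

Set Implicit Arguments.
Unset Strict Implicit.
Unset Printing Implicit Defensive.

Import Order.TTheory GRing.Theory Num.Theory.

Local Open Scope classical_set_scope.
Local Open Scope ring_scope.

(* K_n: symmetry is part of the definition, as K_n is a subset of S_n. *)
Definition psd_cone (R : realType) (n : nat) : set 'M[R]_n :=
  [set A | A \is symmetricmx /\ forall v : 'cV[R]_n, 0 <= (v^T *m A *m v) 0 0].

Definition affine (R : realType) (n : nat) (L : {vspace 'M[R]_n})
    (c : 'M[R]_n) : set 'M[R]_n :=
  [set x + c | x in [set` L]].

(* MathComp-Analysis' own norm `|A| on matrices is the maximum norm. *)
Definition frobenius_norm (R : realType) (n : nat) (A : 'M[R]_n) : R :=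
  Num.sqrt (\sum_i \sum_j A i j ^+ 2).

(* The infimum is taken in the extended reals, so that the distance to the
   empty set is +oo (the infimum of the empty set in R is 0 by convention). *)
Definition frobenius_dist (R : realType) (n : nat) (C D : set 'M[R]_n) :
    \bar R :=
  ereal_inf [set (frobenius_norm (x - y))%:E | x in C & y in D].

Definition weakly_infeasible (R : realType) (n : nat) (K : set 'M[R]_n)
    (L : {vspace 'M[R]_n}) (c : 'M[R]_n) : Prop :=
  affine L c `&` K = set0 /\ frobenius_dist K (affine L c) = 0%E.

(* Main.v *)
Require Import Defs.
From mathcomp Require Import all_boot all_order all_algebra.
From mathcomp Require Import all_classical all_reals ereal.
From mathcomp Require Import topology normedtype ring lra.
Import Order.TTheory GRing.Theory Num.Theory.
Import numFieldNormedType.Exports.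

(* Facial reduction, by induction on n.  If L contains no nonzero positive
   semidefinite matrix, then K_n + L is closed, so an almost feasible problem
   is feasible.  Otherwise pick such an A in L, compress the problem to ker A,
   which has smaller dimension, solve it there by a subspace of dimension less
   than dim (ker A), lift that subspace to L and add the line spanned by A:
   large multiples of A make a matrix that is positive definite on ker A
   positive definite everywhere.  The count of one dimension per step fails
   only if some point of L + c is positive definite, which infeasibility
   excludes. *)

Local Open Scope classical_set_scope.
Local Open Scope ring_scope.

(** * Compactness and continuity *)

(** The points of [S] that meet all constraints up to an error proportional to [d] form nonempty
    closed sets, nested in [d]; by compactness they have a common point. The index type is
    arbitrary, so a whole family indexed by vectors can serve as the constraints. *)
Lemma compact_relaxation (R : realType) (T : topologicalType) (S : set T)
    (I : Type) (p : I -> T -> R) (C : I -> R) :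
  compact S -> closed S -> (forall i, continuous (p i)) ->
  (forall d : R, 0 < d -> exists2 a, S a & forall i, p i a <= d * C i) ->
  exists2 a, S a & forall i, p i a <= 0.
Proof.
move=> cS clS cp feas.
(* The absolute value makes [F d] shrink with [d] whatever the sign of [C i]. *)
pose F (d : R) := S `&` [set a | forall i, p i a <= d * `|C i|].
have clF d : closed (F d).
  apply: closedI => //.
  rewrite (_ : [set _ | _] =
      \bigcap_(i in setT) (p i @^-1` [set x | x <= d * `|C i|])).
    apply: closed_bigI => i _.
    apply: preimage_closed; last exact: closed_le.
    by move=> a _; exact: cp.
  by apply/seteqP; split => [a Ha i _|a Ha i]; [exact: Ha|exact: (Ha i Logic.I)].
have FF : ProperFilter (filter_from [set d : R | 0 < d] F).
  apply: filter_from_proper.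
    apply: filter_from_filter; first by exists 1 => /=.
    move=> d e /= d0 e0; exists (Num.min d e); first by rewrite /= lt_min d0.
    move=> a [Sa Ha]; split; split => // i; apply: le_trans (Ha i) _;
      by rewrite ler_wpM2r // ge_min lexx ?orbT.
  move=> d /= d0; have [a Sa Ha] := feas d d0; exists a; split => // i.
  by apply: le_trans (Ha i) _; rewrite ler_wpM2l ?ler_norm // ltW.
have [|a [Sa Fa]] := cS _ FF; first by exists 1 => //= a [].
exists a => // i; have Fda d : 0 < d -> F d a.
  move=> d0; apply: (clF d) => B aB; apply: Fa aB; by exists d.
apply/ler_addgt0Pr => e e0; rewrite add0r.
have C0 : 0 < `|C i| + 1 by rewrite ltr_wpDl.
have [//|_ /(_ i) H] := Fda (e / (`|C i| + 1)).
  by rewrite divr_gt0.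
apply: le_trans H _; rewrite -mulrA ger_pMr // mulrC ler_pdivrMr // mul1r.
by rewrite lerDl.
Qed.

Lemma continuous_sumr (R : realType) (T : topologicalType) (I : Type)
    (r : seq I) (f : I -> T -> R) :
  (forall i, continuous (f i)) -> continuous (fun x => \sum_(i <- r) f i x).
Proof.
move=> cf; elim: r => [|i r IH].
  by under eq_fun do rewrite big_nil; move=> x; exact: cvg_cst.
under eq_fun do rewrite big_cons.
by move=> x; apply: cvgD; [exact: cf | exact: IH].
Qed.

(** * Quadratic forms and positive definiteness *)

(** Row vectors fit [kermx] and [row_base]; [psd_coneE] translates to the column vectors of
    [psd_cone]. *)
Definition qf {R : realType} {n : nat} (A : 'M[R]_n) (u : 'rV[R]_n) : R :=
  (u *m A *m u^T) 0 0.

(** Symmetry is left out and tracked separately, by equations [A^T = A]. *)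
Definition pos_def {R : realType} {n : nat} (A : 'M[R]_n) : Prop :=
  forall u : 'rV[R]_n, u != 0 -> 0 < qf A u.

(** The norm is the maximum norm, so coordinates on the sphere are at most 1 in absolute value. *)
Definition unit_sphere {R : realType} {n : nat} : set 'rV[R]_n :=
  [set u | `|u| = 1].

Section QuadraticForm.
Variables (R : realType) (n : nat).
Implicit Types (A B : 'M[R]_n) (u : 'rV[R]_n).

Lemma qfE A u : qf A u = \sum_i \sum_j u 0 i * A i j * u 0 j.
Proof.
rewrite /qf mxE exchange_big /=; apply: eq_bigr => j _.
by rewrite !mxE mulr_suml.
Qed.

Lemma qfD A B u : qf (A + B) u = qf A u + qf B u.
Proof. by rewrite /qf mulmxDr mulmxDl mxE. Qed.

Lemma qfZ a A u : qf (a *: A) u = a * qf A u.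
Proof. by rewrite /qf -scalemxAr -scalemxAl mxE. Qed.

Lemma qfN A u : qf (- A) u = - qf A u.
Proof. by rewrite -scaleN1r qfZ mulN1r. Qed.

Lemma qf0 A : qf A 0 = 0.
Proof. by rewrite /qf !mul0mx mxE. Qed.

Lemma qf_homogeneous A a u : qf A (a *: u) = a ^+ 2 * qf A u.
Proof.
by rewrite /qf linearZ /= -scalemxAr -!scalemxAl scalerA mxE expr2.
Qed.

Lemma pos_def_ge0 A u : pos_def A -> 0 <= qf A u.
Proof.
move=> Apd; have [->|/Apd/ltW//] := eqVneq u 0.
by rewrite qf0.
Qed.

Lemma continuous_qf A : continuous (qf A).
Proof.
rewrite (_ : qf A = fun u => \sum_i \sum_j u 0 i * A i j * u 0 j); last first.
  by apply/funext => u; exact: qfE.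
apply: continuous_sumr => i; apply: continuous_sumr => j u.
have cc k : {for u, continuous (fun v : 'rV[R]_n => v 0 k)}.
  exact: coord_continuous.
apply: (@continuousM R _ (fun v : 'rV[R]_n => v 0 i * A i j)
  (fun v => v 0 j)); last exact: cc.
apply: (@continuousM R _ (fun v : 'rV[R]_n => v 0 i) (fun=> A i j)).
  exact: cc.
exact: cst_continuous.
Qed.

Lemma coord_le_norm u i : `|u 0 i| <= `|u|.
Proof.
by rewrite [leRHS]/Num.norm /= mx_normrE; apply/bigmax_geP; right; exists (0, i).
Qed.

Lemma qf_le A u : `|u| <= 1 -> `|qf A u| <= \sum_i \sum_j `|A i j|.
Proof.
move=> u1; have ui i : `|u 0 i| <= 1 by apply: le_trans u1; exact: coord_le_norm.
rewrite qfE; apply: le_trans (ler_norm_sum _ _ _) _; apply: ler_sum => i _.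
apply: le_trans (ler_norm_sum _ _ _) _; apply: ler_sum => j _.
rewrite !normrM mulrAC ler_piMl // mulr_ile1 //.
Qed.

Lemma closed_unit_sphere : closed (@unit_sphere R n).
Proof.
rewrite (_ : @unit_sphere R n = (fun u : 'rV[R]_n => `|u|) @^-1` [set 1]) //.
apply: preimage_closed; last exact: closed_eq.
by move=> u _; exact: norm_continuous.
Qed.

Lemma compact_unit_sphere : compact (@unit_sphere R n).
Proof.
apply: bounded_closed_compact closed_unit_sphere.
by exists 1; split => // M /ltW M1 u /= ->.
Qed.

Lemma normalize_unit_sphere u : u != 0 -> unit_sphere (`|u|^-1 *: u).
Proof.
by move=> u0; rewrite /unit_sphere /= normrZ normfV normr_id mulVf ?normr_eq0.
Qed.

Lemma unit_sphere_neq0 u : unit_sphere u -> u != 0.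
Proof. by move=> u1; rewrite -normr_eq0 u1 oner_eq0. Qed.

(* If no t works, unit vectors u with t qf A u <= - qf Q u accumulate, as
   t tends to infinity, at a unit vector of ker A where qf Q is not positive. *)
Lemma debreu A Q :
  (forall u, 0 <= qf A u) -> (forall u, u != 0 -> qf A u = 0 -> 0 < qf Q u) ->
  exists t : R, pos_def (Q + t *: A).
Proof.
move=> A0 AQ; apply: contrapT => noT.
pose C := \sum_i \sum_j `|Q i j|.
pose p (b : bool) := if b then qf A else qf Q.
(* The constraint on [A] is relaxed to [d * C], the one on [Q] is kept exact. Failure of [t = d^-1]
   at a unit vector [v] gives both: [qf A v <= - d * qf Q v <= d * C], and [qf Q v <= 0] because
   [qf A v] is nonnegative. *)
have [|d d0|u Su Hu] := @compact_relaxation R _ unit_sphere bool p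
    (fun b => if b then C else 0) compact_unit_sphere closed_unit_sphere.
- by case; exact: continuous_qf.
- have /existsNP[u /not_implyP[u0 /negP]] : ~ pos_def (Q + d^-1 *: A).
    by move=> H; apply: noT; exists d^-1.
  rewrite -leNgt qfD qfZ => H.
  exists (`|u|^-1 *: u); first exact: normalize_unit_sphere.
  set v := _ *: u; have Sv : unit_sphere v by exact: normalize_unit_sphere.
  have {}H : qf Q v + d^-1 * qf A v <= 0.
    rewrite !qf_homogeneous mulrCA -mulrDr mulr_ge0_le0 ?exprn_ge0 ?invr_ge0 //.
  have /ler_normlP[_ QC] : `|qf Q v| <= C by apply: qf_le; rewrite Sv.
  have /ler_normlP[QC' _] : `|qf Q v| <= C by apply: qf_le; rewrite Sv.
  case; rewrite /p.
    rewrite -ler_pdivrMl //; lra.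
  rewrite mulr0; have := mulr_ge0 (ltW (_ : 0 < d^-1)) (A0 v).
  rewrite invr_gt0 => /(_ d0); lra.
have /= uA := Hu true; have /= uQ := Hu false.
have /(AQ _ (unit_sphere_neq0 _ Su)) : qf A u = 0 by apply/eqP; rewrite eq_le uA A0.
by rewrite ltNge uQ.
Qed.

End QuadraticForm.


Lemma qf1 (R : realType) n (u : 'rV[R]_n) : qf 1%:M u = \sum_i u 0 i ^+ 2.
Proof.
rewrite /qf mulmx1 mxE; apply: eq_bigr => i _.
by rewrite mxE expr2.
Qed.

Lemma pos_def1 (R : realType) n : pos_def (1%:M : 'M[R]_n).
Proof.
move=> u u0; rewrite qf1 lt_def sumr_ge0 ?andbT => [|i _]; last exact: sqr_ge0.
apply: contra u0; rewrite psumr_eq0 => [/allP H|i _]; last exact: sqr_ge0.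
apply/eqP/rowP => i; rewrite mxE; apply/eqP; rewrite -sqrf_eq0.
by apply: H; rewrite mem_index_enum.
Qed.

(** If [w = u *m A] were nonzero, moving from [u] along a small negative multiple of [w] would make
    the form negative, its linear term being [2 * t * s] with [s] the squared length of [w]. *)
Lemma qf_eq0 (R : realType) n (A : 'M[R]_n) u :
  A^T = A -> (forall v, 0 <= qf A v) -> qf A u = 0 -> u *m A = 0.
Proof.
move=> AT A0 Au; set w := u *m A; apply/eqP; apply: contraT => /pos_def1.
set s := qf 1%:M w => s0.
have qfw t : qf A (u + t *: w) = 2 * t * s + t ^+ 2 * qf A w.
  have uw : u *m A *m w^T = w *m w^T by [].
  have wu : w *m A *m u^T = w *m w^T by rewrite [in RHS]trmx_mul AT mulmxA.
  have -> : s = (w *m w^T) 0 0 by rewrite /s /qf mulmx1.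
  rewrite {1}/qf linearD linearZ /= !mulmxDl !mulmxDr -!scalemxAl -!scalemxAr.
  rewrite uw wu -[RHS]add0r -{1}Au /qf.
  move: (w *m w^T) (u *m A *m u^T) (w *m A *m w^T) => X Y Z.
  rewrite !mxE; ring.
have q0 := A0 w; set q := qf A w in qfw q0.
(* The minimiser would be [- s / q]; the [+ 1] covers [q = 0] and still gives a negative value. *)
have := A0 (u + (- s / (q + 1)) *: w); rewrite qfw.
suff -> : 2 * (- s / (q + 1)) * s + (- s / (q + 1)) ^+ 2 * q =
          - (s ^+ 2 / (q + 1) ^+ 2 * (q + 2)).
  rewrite oppr_ge0 leNgt mulr_gt0 //; last lra.
  by rewrite divr_gt0 // exprn_gt0 //; lra.
field.
by apply/eqP; lra.
Qed.

(** * Lifting a subspace through a linear map *)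

(** Precomposing [f] with the projection onto [L] gives a map [h] whose image contains [M]. A linear
    section of [h] carries [M] back, the projection moves the result into [L], and neither map
    raises the dimension. *)
Lemma lift_subspace (F : fieldType) (vT wT : vectType F) (f : 'Hom(vT, wT))
    (L : {vspace vT}) (M : {vspace wT}) :
  (M <= f @: L)%VS ->
  exists L0 : {vspace vT},
    [/\ (L0 <= L)%VS, (\dim L0 <= \dim M)%N & (f @: L0)%VS = M].
Proof.
move=> ML; pose h := (f \o projv L)%VF.
have MH : (M <= limg h)%VS.
  apply: subv_trans ML _; apply/subvP => _ /memv_imgP[x xL ->].
  apply/memv_imgP; exists x; first exact: memvf.
  by rewrite comp_lfunE projv_id.
have dim_img (V W : vectType F) (g : 'Hom(V, W)) (U : {vspace V}) :
    (\dim (g @: U) <= \dim U)%N.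
  by rewrite -[leqRHS](limg_ker_dim g) leq_addl.
exists (projv L @: ((h^-1)%VF @: M))%VS; split.
- by apply/subvP => _ /memv_imgP[x _ ->]; exact: memv_proj.
- exact: leq_trans (dim_img _ _ _ _) (dim_img _ _ _ _).
- rewrite -!limg_comp; apply/vspaceP => y; apply/memv_imgP/idP => [[x xM ->]|yM].
    by rewrite -/h comp_lfunE limg_lfunVK // (subvP MH).
  by exists y; rewrite // -/h comp_lfunE limg_lfunVK // (subvP MH).
Qed.

(** * Base case: no nonzero positive semidefinite matrix in [L] *)

Section BaseCase.
Variables (R : realType) (n : nat) (L : {vspace 'M[R]_n}).

Let f (a : 'rV[R]_(\dim L)) : 'M[R]_n := \sum_i a 0 i *: (vbasis L)`_i.

Let f_mem a : f a \in L.
Proof.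
by apply: memv_suml => i _; apply/memvZ/vbasis_mem/mem_nth; rewrite size_tuple.
Qed.

Let f_onto x : x \in L -> exists a, x = f a.
Proof.
move=> xL; exists (\row_i coord (vbasis L) i x).
rewrite {1}(coord_vbasis xL); apply: eq_bigr => i _; by rewrite mxE.
Qed.

Let f_inj a : f a = 0 -> a = 0.
Proof.
move=> fa; apply/rowP => i; rewrite mxE.
by have /freeP H := basis_free (vbasisP L); exact: (H (fun i => a 0 i) fa).
Qed.

Let fZ k a : f (k *: a) = k *: f a.
Proof.
by rewrite /f scaler_sumr; apply: eq_bigr => i _; rewrite mxE scalerA.
Qed.

Let qff a u : qf (f a) u = \sum_i a 0 i * qf (vbasis L)`_i u.
Proof.
rewrite /f; elim/big_rec2: _ => [|i y1 y2 _ <-].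
  by rewrite /qf mulmx0 mul0mx mxE.
by rewrite qfD qfZ.
Qed.

Let continuous_f c u : continuous (fun a => - qf (f a + c) u).
Proof.
have cg : continuous (fun a : 'rV[R]_(\dim L) =>
    \sum_i a 0 i * qf (vbasis L)`_i u).
  apply: continuous_sumr => i a.
  apply: (@continuousM R _ (fun a : 'rV[R]_(\dim L) => a 0 i) (fun=> _)).
    exact: coord_continuous.
  exact: cst_continuous.
under eq_fun do rewrite qfD qff.
move=> a; apply: (@continuousN R R _ (fun a => _)).
apply: continuousD; [exact: cg | exact: cst_continuous].
Qed.

(* A bounded family of approximate solutions has a limit point; an unbounded
   one, rescaled, would converge to a nonzero recession direction. *)
Lemma feasible_of_no_recession (E c : 'M[R]_n) :
  pos_def E ->
  (forall x, x \in L -> (forall u, 0 <= qf x u) -> x = 0) ->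
  (forall e : R, 0 < e -> exists2 x, x \in L & pos_def (x + c + e *: E)) ->
  exists2 x, x \in L & forall u, 0 <= qf (x + c) u.
Proof.
move=> Epd L0 app.
(* A uniform margin: otherwise compactness of the coordinate sphere yields a nonzero positive
   semidefinite element of [L]. *)
have [d d0 Hd] : exists2 d : R, 0 < d & forall a, unit_sphere a ->
    ~ (forall u, 0 <= qf (f a + d *: E) u).
  apply: contrapT => H.
  have [|d d0|a Sa Ha] := @compact_relaxation R _ (@unit_sphere R (\dim L)) _
    (fun u a => - qf (f a + 0) u) (fun u => qf E u) (@compact_unit_sphere _ _)
    (@closed_unit_sphere _ _).
  - by move=> u; exact: continuous_f.
  - apply: contrapT => H'; apply: H; exists d => // a Sa Ha; apply: H'.
    by exists a => // u; have := Ha u; rewrite qfD qfZ addr0; lra.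
  have /f_inj a0 : f a = 0.
    by apply: L0 => // u; have := Ha u; rewrite addr0 oppr_le0.
  by have := unit_sphere_neq0 _ _ _ Sa; rewrite a0 eqxx.
(* [E] vanishes at no nonzero vector, so the second hypothesis of [debreu] holds vacuously; [c] is
   thus bounded above by [t *: E]. *)
have [t Ht] : exists t : R, pos_def (- c + t *: E).
  apply: debreu => [u|u /Epd]; first exact: pos_def_ge0.
  by move=> /gt_eqF/eqP.
(* For [e <= 1] the form of [f a + (1 + t) *: E] is nonnegative. If [M] were less than the norm of
   [a], dividing by that norm would leave at most [d *: E] beside a unit element, against the
   margin. *)
pose M := (1 + `|t|) / d.
have bnd a e : 0 < e -> e <= 1 -> pos_def (f a + c + e *: E) -> `|a| <= M.
  move=> e0 e1 Hp; rewrite leNgt; apply/negP => Ma.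
  have M0 : 0 < M by rewrite divr_gt0 // ltr_pwDl.
  have a0 : 0 < `|a| by exact: lt_trans Ma.
  apply: (Hd (`|a|^-1 *: a)).
    by apply: normalize_unit_sphere; rewrite -normr_eq0 gt_eqF.
  move=> u; rewrite fZ qfD !qfZ.
  have h1 := pos_def_ge0 _ _ _ u Hp; have h2 := pos_def_ge0 _ _ _ u Ht.
  have h3 := pos_def_ge0 _ _ _ u Epd.
  rewrite !qfD ?qfN !qfZ in h1 h2.
  have h4 : t * qf E u <= `|t| * qf E u by rewrite ler_wpM2r ?ler_norm.
  have h5 : e * qf E u <= 1 * qf E u by rewrite ler_wpM2r.
  have h6 : 1 + `|t| <= d * `|a|.
    by rewrite -ler_pdivrMl // mulrC ltW.
  have h7 := ler_wpM2r h3 h6.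
  rewrite -(pmulr_rge0 _ a0) mulrDr mulrA divff ?gt_eqF // mul1r.
  rewrite mulrA [_ * d]mulrC; lra.
pose S := [set a : 'rV[R]_(\dim L) | `|a| <= M].
have clS : closed S.
  rewrite (_ : S = (fun a : 'rV[R]_(\dim L) => `|a|) @^-1` [set x | x <= M]) //.
  apply: preimage_closed; last exact: closed_le.
  by move=> a _; exact: norm_continuous.
have cS : compact S.
  apply: bounded_closed_compact clS.
  by exists M; split; [exact: num_real | move=> y /ltW My a /= /le_trans; apply].
have [|e e0|a _ Ha] := @compact_relaxation R _ S _
    (fun u a => - qf (f a + c) u) (fun u => qf E u) cS clS.
- by move=> u; exact: continuous_f.
(* Capping the error at 1 makes the bound [bnd] applicable. *)
- have e'0 : 0 < Num.min e 1 by rewrite lt_min e0 ltr01.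
  have [x /f_onto[a ->] Ha] := app _ e'0.
  have e1 : Num.min e 1 <= 1 by rewrite ge_min lexx orbT.
  have ee : Num.min e 1 <= e by rewrite ge_min lexx.
  exists a => [|u]; first exact: bnd Ha.
  have := pos_def_ge0 _ _ _ u Ha; have h3 := pos_def_ge0 _ _ _ u Epd.
  have := ler_wpM2r h3 ee; rewrite [qf (_ + _ *: _) _]qfD qfZ; lra.
by exists (f a) => // u; have := Ha u; rewrite oppr_le0.
Qed.

End BaseCase.


(** * Compression to a kernel and the induction *)

(** A general [E] is allowed because compression turns the identity into [N *m N^T], which need not
    be the identity. *)
Definition almost_feasible {R : realType} {n : nat} (E : 'M[R]_n)
    (L : {vspace 'M[R]_n}) (c : 'M[R]_n) : Prop :=
  forall e : R, 0 < e -> exists2 x, x \in L & pos_def (x + c + e *: E).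

Definition compression {R : realType} {k n : nat} (N : 'M[R]_(k, n)) :
    'Hom('M[R]_n, 'M[R]_k) :=
  linfun (mulmxr N^T \o mulmx N).

Section Compression.
Variables (R : realType) (k n : nat) (N : 'M[R]_(k, n)).
Implicit Types A Q : 'M[R]_n.

Lemma compressionE A : compression N A = N *m A *m N^T.
Proof. by rewrite lfunE. Qed.

Lemma trmx_compression A : (compression N A)^T = compression N A^T.
Proof. by rewrite !compressionE !trmx_mul trmxK mulmxA. Qed.

Lemma qf_compression A u : qf (compression N A) u = qf A (u *m N).
Proof. by rewrite compressionE /qf trmx_mul !mulmxA. Qed.

Lemma pos_def_compression A :
  row_free N -> pos_def A -> pos_def (compression N A).
Proof.
move=> Nf Apd u u0; rewrite qf_compression; apply: Apd.
apply: contra u0 => /eqP uN; apply/eqP/(row_free_inj Nf).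
by rewrite uN mul0mx.
Qed.

End Compression.

(** By [qf_eq0] the form of [A] vanishes only on its kernel, where the form of [Q] is that of the
    compression; [debreu] then applies. *)
Lemma extend_pos_def (R : realType) (n : nat) (A Q : 'M[R]_n) :
  A^T = A -> (forall u, 0 <= qf A u) ->
  pos_def (compression (row_base (kermx A)) Q) ->
  exists t : R, pos_def (Q + t *: A).
Proof.
move=> AT A0 Qpd; apply: debreu => // u u0 /(qf_eq0 _ _ _ _ AT A0) /sub_kermxP uA.
have [v def_u] : exists v, u = v *m row_base (kermx A).
  by apply/submxP; rewrite eq_row_base.
rewrite def_u -qf_compression; apply: Qpd.
by apply: contra u0 => /eqP v0; rewrite def_u v0 mul0mx.
Qed.

(** The second alternative originates at size 0, where no dimension is below [n] but every matrix is
    vacuously positive definite; [extend_pos_def] carries it up through the induction. *)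
Lemma exists_small_subspace (R : realType) (n : nat) (E : 'M[R]_n)
    (L : {vspace 'M[R]_n}) (c : 'M[R]_n) :
  pos_def E -> (forall x, x \in L -> x^T = x) -> almost_feasible E L c ->
  exists (L' : {vspace 'M[R]_n}) (y : 'M[R]_n),
    [/\ (L' <= L)%VS, y \in L, almost_feasible E L' (y + c) &
        (\dim L' < n)%N \/ exists2 x, x \in L' & pos_def (x + (y + c))].
Proof.
elim/ltn_ind: n => n IH in E L c *.
move=> Epd Lsym app.
have [Lrec|] := pselect (forall x, x \in L -> (forall u, 0 <= qf x u) -> x = 0).
  (* Here [y + c] is itself feasible, so the zero subspace suffices: adding [e *: E] makes it
     positive definite. *)
  have [y yL y0] := feasible_of_no_recession _ _ _ _ _ Epd Lrec app.
  exists 0%VS, y; split => //; first exact: sub0v.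
    move=> e e0; exists 0; rewrite ?mem0v // add0r => u u0.
    by rewrite qfD qfZ ltr_wpDl // mulr_gt0 // Epd.
  case: (posnP n) => [n0|]; last by rewrite dimv0; left.
  right; exists 0; first exact: mem0v.
  move=> u /negP[]; apply/eqP/rowP => -[i lt_in].
  by exfalso; rewrite n0 in lt_in.
move=> /existsNP[A /not_implyP[AL /not_implyP[A0 /eqP nzA]]].
have AT := Lsym A AL.
have kn : (\rank (kermx A) < n)%N.
  rewrite mxrank_ker -subn_gt0 subKn ?rank_leq_row //.
  by rewrite lt0n mxrank_eq0.
pose N := row_base (kermx A); pose f := compression N.
have Nf : row_free N by exact: row_base_free.
have [|_ /memv_imgP[x xL ->]|e e0|M [_ [ML /memv_imgP[y yL ->] Mapp Mdim]]] :=
    IH _ kn (f E) (f @: L)%VS (f c).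
- exact: pos_def_compression.
- by rewrite trmx_compression Lsym.
- have [x xL xpd] := app e e0; exists (f x); first exact: memv_img.
  by rewrite -linearZ -!linearD; exact: pos_def_compression.
have [L0 [L0L dimL0 fL0]] := lift_subspace _ _ _ _ _ _ ML.
(* The multiple of [A] depends on [e], so the whole line is added. *)
exists (L0 + <[A]>)%VS, y; split => //.
- by rewrite subv_add L0L -memvE.
- move=> e /Mapp[z]; rewrite -fL0 => /memv_imgP[x xL0 ->].
  rewrite -linearZ -!linearD => /(extend_pos_def _ _ _ _ AT A0)[t].
  rewrite addrAC [x + _ + t *: A]addrAC => tpd.
  by exists (x + t *: A) => //; rewrite memv_add // memvZ // memv_line.
case: Mdim => [dimM|[z]].
  (* With [k] the dimension of the kernel, [\dim L0 <= \dim M < k < n] leaves room for one more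
     dimension. *)
  left; apply: leq_ltn_trans (_ : (\dim L0 + 1 < n)%N); last first.
    by rewrite addn1; apply: leq_trans kn; rewrite ltnS (leq_ltn_trans dimL0).
  apply: leq_trans (_ : (\dim L0 + \dim <[A]> <= _)%N).
    by case: (dimv_add_leqif L0 <[A]>).
  by rewrite leq_add2l dim_vline leq_b1.
rewrite -fL0 => /memv_imgP[x xL0 ->].
rewrite -!linearD => /(extend_pos_def _ _ _ _ AT A0)[t tpd].
right; exists (x + t *: A); last by rewrite addrAC.
by rewrite memv_add // memvZ // memv_line.
Qed.

(** * From distance zero to almost feasibility and back *)

Lemma symmetricmxP (R : realType) (n : nat) (A : 'M[R]_n) :
  reflect (A^T = A) (A \is symmetricmx).
Proof.
rewrite is_hermitianmxE expr0 scale1r map_mx_id // eq_sym.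
exact: eqP.
Qed.

Lemma psd_coneE (R : realType) (n : nat) (A : 'M[R]_n) :
  psd_cone A <-> A^T = A /\ forall u, 0 <= qf A u.
Proof.
split=> -[/symmetricmxP AT A0]; split => //; try exact/symmetricmxP.
  by move=> u; have := A0 u^T; rewrite trmxK.
by move=> v; have := A0 v^T; rewrite /qf trmxK.
Qed.

Lemma entry_le_frobenius (R : realType) (n : nat) (A : 'M[R]_n) i j :
  `|A i j| <= frobenius_norm A.
Proof.
rewrite -sqrtr_sqr ler_wsqrtr // (bigD1 i) //= (bigD1 j) //= -addrA lerDl.
by rewrite addr_ge0 // ?sumr_ge0 // => *; rewrite ?sumr_ge0 // => *;
  exact: sqr_ge0.
Qed.

(** Each entry is at most the Frobenius norm, and a product of two coordinates is at most half the
    sum of their squares; summing over all pairs produces the factor [n]. *)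
Lemma qf_le_frobenius (R : realType) (n : nat) (A : 'M[R]_n) u :
  qf A u <= n%:R * frobenius_norm A * qf 1%:M u.
Proof.
have AF i j : u 0 i * A i j * u 0 j
    <= frobenius_norm A / 2 * (u 0 i ^+ 2 + u 0 j ^+ 2).
  have /ler_normlP[] := entry_le_frobenius _ _ A i j.
  move: (frobenius_norm A) (A i j) (u 0 i) (u 0 j) => F a x y h1 h2.
  have := mulr_ge0 (_ : 0 <= F - a) (sqr_ge0 (x - y)).
  have := mulr_ge0 (_ : 0 <= F + a) (sqr_ge0 (x + y)).
  (* This product and the next add up to [2 * F * (x ^+ 2 + y ^+ 2) - 4 * a * x * y]. *)
  have := mulr_ge0 (_ : 0 <= F + a) (sqr_ge0 (x - y)).
  have := mulr_ge0 (_ : 0 <= F - a) (sqr_ge0 (x + y)).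
  nra.
rewrite qfE qf1.
apply: (@le_trans _ _ (\sum_i \sum_j
    frobenius_norm A / 2 * (u 0 i ^+ 2 + u 0 j ^+ 2))).
  by apply: ler_sum => i _; apply: ler_sum => j _; exact: AF.
under eq_bigr do rewrite -mulr_sumr big_split /= sumr_const card_ord.
rewrite -mulr_sumr big_split /= sumr_const card_ord sumrMnl.
rewrite -mulr_natr; lra.
Qed.

Lemma almost_feasible_of_dist (R : realType) (n : nat) (L : {vspace 'M[R]_n})
    (c : 'M[R]_n) :
  frobenius_dist (@psd_cone R n) (affine L c) = 0%E -> almost_feasible 1%:M L c.
Proof.
move=> d0 e e0.
(* Dividing by [n.+1] instead of [n] covers size 0; a point this close to the cone has a form that
   [e *: 1%:M] makes positive. *)
have n0 : 0 < n.+1%:R :> R by rewrite ltr0n.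
have : (frobenius_dist (@psd_cone R n) (affine L c) < (e / n.+1%:R)%:E)%E.
  by rewrite d0 lte_fin divr_gt0.
move=> /ereal_inf_lt[_ [x /psd_coneE[_ x0] [_ [z zL <-] <-]]].
rewrite lte_fin => xz; exists z => // u /pos_def1 u0.
have := qf_le_frobenius _ _ (x - (z + c)) u; rewrite qfD qfN => h.
have hx := x0 u; rewrite [qf (_ + e *: _) u]qfD qfZ.
have : n%:R * frobenius_norm (x - (z + c)) < e.
  rewrite ltr_pdivlMr // mulrC in xz; apply: le_lt_trans xz.
  by rewrite ler_wpM2r ?sqrtr_ge0 // ler_nat.
rewrite -(ltr_pM2r u0); lra.
Qed.

Lemma frobenius_dist0_of_almost_feasible (R : realType) (n : nat)
    (L : {vspace 'M[R]_n}) (c : 'M[R]_n) :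
  (forall x, x \in L -> x^T = x) -> c^T = c -> almost_feasible 1%:M L c ->
  frobenius_dist (@psd_cone R n) (affine L c) = 0%E.
Proof.
move=> Lsym csym app; apply/eqP; rewrite eq_le; apply/andP; split; last first.
  apply/ereal_infP => _ [x _ [y _ <-]].
  by rewrite lee_fin sqrtr_ge0.
apply/lee_addgt0Pr => e e0; rewrite add0e.
pose F := frobenius_norm (1%:M : 'M[R]_n).
have F0 : 0 <= F by exact: sqrtr_ge0.
have F1 : 0 < F + 1 by rewrite ltr_wpDl.
(* Shifting by [d *: 1%:M] costs distance [d * F], which this choice keeps below [e] even when
   [F = 0]. *)
have d0 : 0 < e / (F + 1) by rewrite divr_gt0.
have [x xL xpd] := app _ d0; set d := e / (F + 1) in d0 xpd.
apply: (@le_trans _ _ (d * F)%:E); last first.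
  by rewrite lee_fin /d -mulrA ger_pMr // mulrC ler_pdivrMr // mul1r lerDl ler01.
apply: ereal_inf_lbound; exists (x + c + d *: 1%:M).
  apply/psd_coneE; split; last by move=> u; exact: pos_def_ge0.
  by rewrite !linearD linearZ /= trmx1 Lsym // csym.
exists (x + c); first by exists x.
rewrite addrAC subrr add0r; congr (_%:E).
rewrite /F /frobenius_norm -[d in RHS](ger0_norm (ltW d0)).
rewrite -sqrtr_sqr -sqrtrM ?sqr_ge0 //.
rewrite mulr_sumr; congr (Num.sqrt _); apply: eq_bigr => i _.
by rewrite mulr_sumr; apply: eq_bigr => j _; rewrite mxE exprMn.
Qed.

Theorem theorem10 (R : realType) (n : nat) (L : {vspace 'M[R]_n}) (c : 'M[R]_n)
    (L_sym : forall x : 'M[R]_n, x \in L -> x \is symmetricmx)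
    (c_sym : c \is symmetricmx) :
  weakly_infeasible (@psd_cone R n) L c ->
  exists (L' : {vspace 'M[R]_n}) (c' : 'M[R]_n),
    [/\ forall x : 'M[R]_n, x \in L' -> x \is symmetricmx,
        c' \is symmetricmx,
        (\dim L' <= n - 1)%N,
        affine L' c' `<=` affine L c &
        weakly_infeasible (@psd_cone R n) L' c'].
Proof.
move=> [infeas /almost_feasible_of_dist app].
have LT x : x \in L -> x^T = x by move=> /L_sym /symmetricmxP.
have cT : c^T = c by exact/symmetricmxP.
have [L' [y [L'L yL app' dimL']]] :=
  exists_small_subspace _ _ _ _ _ (pos_def1 _ _) LT app.
have sub : affine L' (y + c) `<=` affine L c.
  move=> _ [x xL' <-]; exists (x + y); last by rewrite addrA.
  by apply: memvD => //; exact: subvP L'L _ _.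
have ycT : (y + c)^T = y + c by rewrite linearD /= LT // cT.
have infeas' : affine L' (y + c) `&` @psd_cone R n = set0.
  by rewrite -subset0 -infeas; exact: setSI.
have L'T x : x \in L' -> x^T = x by move=> /(subvP L'L)/LT.
exists L', (y + c); split => //.
- by move=> x /(subvP L'L)/L_sym.
- exact/symmetricmxP.
(* Subtraction is truncated, but [\dim L' < n] forces [n] to be positive. A positive definite point
   would be feasible. *)
- case: dimL' => [lt|[x xL' xpd]].
    by rewrite -ltnS subn1 prednK // (leq_ltn_trans _ lt).
  exfalso; have : (affine L' (y + c) `&` @psd_cone R n) (x + (y + c)).
    split; first by exists x.
    apply/psd_coneE; split; first by rewrite linearD /= L'T // ycT.
    by move=> u; exact: pos_def_ge0.
  by rewrite infeas'.
- split => //; exact: frobenius_dist0_of_almost_feasible.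
Qed.
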